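(* Let $A,C\in\mathcal{S}^+_{m,n}$. Then $A\le_B C$ if and only if $A$ can be obtained from $C$ by a sequence of operations of the following forms: (i) a Bruhat interchange; (ii) replacing a zero column by a coordinate vector $e_i\in\mathbb{R}^m$; (iii) replacing a column equal to $e_k$ by $e_i$ where $i<k$; (iv) interchanging a nonzero column $j$ with a zero column $k$, where $k<j$.
   Context: $\mathcal{S}^+_{m,n}$ is the set of $m\times n$ $(0,1)$-matrices with at most one $1$ in each column. The sum-matrix of $A=[a_{ij}]$ is $\Sigma(A)=[\sigma_{ij}]$ with $\sigma_{ij}=\sum_{p\le i,\,q\le j}a_{pq}$, and $A\le_B C$ means $\Sigma(A)\ge\Sigma(C)$ entrywise. A Bruhat interchange replaces a $2\times 2$ submatrix (rows $i<i'$, columns $j<j'$, not necessarily consecutive) equal to $\begin{bmatrix}0&1\\1&0\end{bmatrix}$ by $\begin{bmatrix}1&0\\0&1\end{bmatrix}$. $e_i$ denotes the $i$-th standard unit vector in $\mathbb{R}^m$. *)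

(* Defs.v *)
From Stdlib Require Import Relations.
From mathcomp Require Import all_boot all_algebra.

Set Implicit Arguments.
Unset Strict Implicit.
Unset Printing Implicit Defensive.

Import GRing.Theory.
Local Open Scope ring_scope.

(* (0,1)-matrices are matrices of natural numbers with entries in {0, 1}, so
   that the partial sums below are ordinary sums of entries. *)
Definition zero_one_mx (m n : nat) (A : 'M[nat]_(m, n)) : Prop :=
  forall i j, (A i j = 0%N) \/ (A i j = 1%N).

Definition Splus (m n : nat) (A : 'M[nat]_(m, n)) : Prop :=
  zero_one_mx A /\ forall j : 'I_n, (#|[set i | A i j == 1%N]| <= 1)%N.

Definition sum_mx (m n : nat) (A : 'M[nat]_(m, n)) : 'M[nat]_(m, n) :=
  \matrix_(i, j)
    (\sum_(p < m | (p <= i)%N) \sum_(q < n | (q <= j)%N) A p q)%N.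

(* A is the smaller matrix: larger partial sums mean lower in the order. *)
Definition bruhat_le (m n : nat) (A C : 'M[nat]_(m, n)) : Prop :=
  forall i j, (sum_mx C i j <= sum_mx A i j)%N.

Definition unit_vec (m : nat) (i : 'I_m) : 'cV[nat]_m := delta_mx i 0.

Definition set_col (m n : nat) (j : 'I_n) (v : 'cV[nat]_m)
    (A : 'M[nat]_(m, n)) : 'M[nat]_(m, n) :=
  \matrix_(p, q) (if q == j then v p 0 else A p q).

(* For each of the operations, up to [operation], C is the matrix before the
   operation and A is the result. *)
Definition bruhat_interchange (m n : nat) (C A : 'M[nat]_(m, n)) : Prop :=
  exists (i i' : 'I_m) (j j' : 'I_n),
    [/\ (i < i')%N,
        (j < j')%N,
        [/\ C i j = 0%N, C i j' = 1%N, C i' j = 1%N & C i' j' = 0%N],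
        [/\ A i j = 1%N, A i j' = 0%N, A i' j = 0%N & A i' j' = 1%N]
      & forall p q, ~~ ((p \in [:: i; i']) && (q \in [:: j; j'])) ->
          A p q = C p q].

Definition zero_col_fill (m n : nat) (C A : 'M[nat]_(m, n)) : Prop :=
  exists (j : 'I_n) (i : 'I_m),
    col j C = 0 /\ A = set_col j (unit_vec i) C.

Definition unit_col_raise (m n : nat) (C A : 'M[nat]_(m, n)) : Prop :=
  exists (j : 'I_n) (i k : 'I_m),
    [/\ (i < k)%N, col j C = unit_vec k & A = set_col j (unit_vec i) C].

Definition zero_col_interchange (m n : nat) (C A : 'M[nat]_(m, n)) : Prop :=
  exists j k : 'I_n,
    [/\ (k < j)%N, col j C <> 0, col k C = 0 & A = xcol j k C].

Definition operation (m n : nat) (C A : 'M[nat]_(m, n)) : Prop :=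
  [\/ bruhat_interchange C A, zero_col_fill C A, unit_col_raise C A
    | zero_col_interchange C A].

Definition obtainable_from (m n : nat) (A C : 'M[nat]_(m, n)) : Prop :=
  clos_refl_trans 'M[nat]_(m, n) (@operation m n) C A.

(* Main.v *)
From Stdlib Require Import Relations.
Require Import Defs.
From mathcomp Require Import all_boot all_algebra zify.

(** A matrix in S^+ is a word f, where f j is the row of the 1 in column j, or
    m if column j is zero.  The Bruhat order then compares, for all i and q, the
    number of letters below i in the prefix ending at q.  Operations (i) and
    (iv) swap two letters so that the smaller one comes first, and (ii) and
    (iii) lower one letter.  Given h below f, let j be the first position where
    they differ; then h j < f j.  If some later letter of f lies in
    [h j, f j[, swapping the first such letter with f j keeps f above h; if
    there is none, f j can be lowered to h j directly.  Repeating this fixes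
    the columns from left to right. *)

Set Implicit Arguments.
Unset Strict Implicit.
Unset Printing Implicit Defensive.

Section Words.
Variables m n : nat.
Implicit Types f g h : {ffun 'I_n -> 'I_m.+1}.

(** * Words, their order and the moves on them *)

Definition word_mx f : 'M[nat]_(m, n) :=
  (\matrix_(i, j) ((f j : nat) == i : nat))%R.

(** The strict bound shifts the row index by one: the threshold [i.+1] gives the sum-matrix entry in
    row [i]. The letter [m] of a zero column is not counted for any [i <= m]. *)
Definition prefix_count f (i q : nat) : nat :=
  \sum_(p < n) ((p <= q) && (f p < i)).

Definition word_le h f : Prop :=
  forall i (q : 'I_n), i <= m -> prefix_count f i q <= prefix_count h i q.

Definition lowering f g : Prop :=
  exists j, g j < f j /\ forall p, p != j -> g p = f p.

Definition descent_swap f g : Prop :=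
  exists j k : 'I_n,
    [/\ j < k, f k < f j, g j = f k, g k = f j
      & forall p, p != j -> p != k -> g p = f p].

Definition word_step f g : Prop := lowering f g \/ descent_swap f g.

Lemma prefix_count_lowering f g (j : 'I_n) i q :
    g j < f j -> (forall p, p != j -> g p = f p) ->
  prefix_count g i q = prefix_count f i q + [&& j <= q, g j < i & i <= f j].
Proof.
move=> ltj eqp; rewrite /prefix_count (bigD1 j) //= [in RHS](bigD1 j) //=.
under eq_bigr => p pj do rewrite eqp //.
by lia.
Qed.

Lemma prefix_count_swap f g (j k : 'I_n) i q :
    j < k -> f k < f j -> g j = f k -> g k = f j ->
    (forall p, p != j -> p != k -> g p = f p) ->
  prefix_count g i q
    = prefix_count f i q + [&& j <= q, q < k, f k < i & i <= f j].
Proof.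
move=> jk ltf gj gk eqp.
have kj : k != j by rewrite -val_eqE /=; lia.
rewrite /prefix_count (bigD1 j) //= [in RHS](bigD1 j) //=.
rewrite (bigD1 k) //= [in RHS](bigD1 k) //= gj gk.
under eq_bigr => p /andP[pj pk] do rewrite eqp //.
by lia.
Qed.

Lemma word_step_le f g : word_step f g -> word_le g f.
Proof.
case=> [[j [ltj eqp]]|[j [k [jk ltf gj gk eqp]]]] i q _.
  by rewrite (prefix_count_lowering i q ltj eqp) leq_addr.
by rewrite (prefix_count_swap i q jk ltf gj gk eqp) leq_addr.
Qed.

(** * Moving down from a word to a smaller one *)

Lemma prefix_count_split f a i q : a <= i ->
  prefix_count f i q
    = prefix_count f a q + \sum_(p < n) [&& p <= q, a <= f p & f p < i].
Proof.
by move=> ai; rewrite -big_split /=; apply: eq_bigr => p _; lia.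
Qed.

(** This slack pays for the unit that a move on [f] adds to a count. Split both counts at the
    threshold [h j]. Below it, the order gives the inequality. In [[h j, i[], the words agree before
    [j], position [j] counts only for [h], and from there to [q] the word [f] has no such letter. *)
Lemma prefix_count_lt f h (j : 'I_n) i (q : 'I_n) :
    word_le h f -> (forall p : 'I_n, p < j -> h p = f p) ->
    h j < i -> i <= f j -> j <= q ->
    (forall p : 'I_n, j < p <= q -> ~~ (h j <= f p < f j)) ->
  prefix_count f i q < prefix_count h i q.
Proof.
move=> lehf agree hi fi jq none.
have im : i <= m by have := ltn_ord (f j); lia.
have ham : h j <= m by have := ltn_ord (h j); lia.
rewrite !(prefix_count_split _ _ (ltnW hi)) -addnS.
apply: leq_add; first exact: lehf.
rewrite (bigD1 j) //= [leqRHS](bigD1 j) //=.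
have -> : [&& j <= q, h j <= f j & f j < i] = false by lia.
rewrite jq leqnn hi add0n add1n ltnS.
apply: leq_sum => p pj.
have [pltj|jltp|/val_inj epj] := ltngtP p j.
- by rewrite (agree p).
- case: (leqP p q) => //= pq; have := none p; rewrite jltp pq => /(_ isT).
  by case: (leqP (h j) (f p)) => //=; lia.
- by rewrite epj eqxx in pj.
Qed.

(** Were [f j] the smaller letter, the prefix ending at [j] would contain one more letter below
    [(f j).+1] in [f] than in [h]. *)
Lemma word_le_first_diff f h (j : 'I_n) :
    word_le h f -> (forall p : 'I_n, p < j -> h p = f p) -> h j <= f j.
Proof.
move=> lehf agree; rewrite leqNgt; apply/negP => ltfh.
have hjm : (f j).+1 <= m by have := ltn_ord (h j); lia.
have := lehf (f j).+1 j hjm.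
rewrite /prefix_count (bigD1 j) //= [leqRHS](bigD1 j) //=.
suff -> : \sum_(p < n | p != j) ((p <= j) && (h p < (f j).+1))
   = \sum_(p < n | p != j) ((p <= j) && (f p < (f j).+1)).
  by rewrite leq_add2r !leqnn [h j < _]leqNgt ltnS ltfh.
apply: eq_bigr => p pj.
have [pltj|jltp|/val_inj epj] := ltngtP p j => //; first by rewrite agree.
by rewrite epj eqxx in pj.
Qed.

Lemma exists_word_step f h (j : 'I_n) :
    word_le h f -> (forall p : 'I_n, p < j -> h p = f p) -> h j < f j ->
  exists g, [/\ word_step f g, word_le h g,
    forall p : 'I_n, p < j -> h p = g p & g j < f j].
Proof.
move=> lehf agree ltj.
pose P (k : 'I_n) := (j < k) && (h j <= f k < f j).
case: (pickP P) => [k0 Pk0|noP]; last first.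
  pose g := [ffun p => if p == j then h j else f p].
  have gj : g j = h j by rewrite ffunE eqxx.
  have eqp p : p != j -> g p = f p by rewrite ffunE => /negPf->.
  have gltf : g j < f j by rewrite gj.
  exists g; split=> //.
  - by left; exists j.
  - move=> i q im; rewrite (prefix_count_lowering i q gltf eqp) gj.
    case: and3P => [[jq hi fi]|_]; last by rewrite addn0 lehf.
    rewrite addn1; apply: prefix_count_lt hi fi jq _ => // p /andP[jp _].
    by have := noP p; rewrite /P jp /= => ->.
  - by move=> p pj; rewrite eqp ?agree // -val_eqE /=; lia.
(* The swap changes only counts of prefixes ending before [k]. By minimality of [k], these have no
   letter of [f] in [[h j, f j[] after [j], so [prefix_count_lt] applies. *)
have [k /andP[jk /andP[hk kf]] kmin] := arg_minnP (fun k : 'I_n => k : nat) Pk0.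
have kj : k != j by rewrite -val_eqE /=; lia.
pose g := [ffun p => if p == j then f k else if p == k then f j else f p].
have gj : g j = f k by rewrite ffunE eqxx.
have gk : g k = f j by rewrite ffunE (negPf kj) eqxx.
have eqp p : p != j -> p != k -> g p = f p.
  by rewrite ffunE => /negPf-> /negPf->.
exists g; split.
- by right; exists j, k.
- move=> i q im; rewrite (prefix_count_swap i q jk kf gj gk eqp).
  case: and4P => [[jq qk ki fi]|_]; last by rewrite addn0 lehf.
  rewrite addn1; apply: (@prefix_count_lt _ _ j) => //; first by lia.
  move=> p /andP[jp pq]; apply/negP => fp.
  by have := kmin p; rewrite /P jp fp => /(_ isT); lia.
- by move=> p pj; rewrite eqp ?agree // -val_eqE /=; lia.
- by rewrite gj.
Qed.

Lemma fix_next_letter h (j : 'I_n) f :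
    word_le h f -> (forall p : 'I_n, p < j -> h p = f p) ->
  exists g, [/\ clos_refl_trans _ word_step f g, word_le h g
    & forall p : 'I_n, p <= j -> h p = g p].
Proof.
(* A swap may leave the letter at [j] above [h j], but each move strictly lowers it, so induct on a
   bound for it. *)
have [c] := ubnP (f j : nat); elim: c f => // c IHc f fc lehf agree.
have := word_le_first_diff lehf agree; rewrite leq_eqVlt => /orP[/eqP eqj|ltj].
  exists f; split=> //; first exact: rt_refl.
  by move=> p; rewrite leq_eqVlt => /orP[/eqP/val_inj->|/agree//]; apply/val_inj.
have [g [stepg lehg agreeg ltg]] := exists_word_step lehf agree ltj.
have [|g' [stepg' lehg' agreeg']] := IHc g _ lehg agreeg; first by lia.
by exists g'; split=> //; apply: rt_trans stepg'; apply: rt_step.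
Qed.

Lemma word_le_steps h f : word_le h f -> clos_refl_trans _ word_step f h.
Proof.
move=> lehf.
suff fixed t : t <= n -> exists g, [/\ clos_refl_trans _ word_step f g,
    word_le h g & forall p : 'I_n, p < t -> h p = g p].
  have [g [stepg _ agree]] := fixed n (leqnn n).
  by have -> : h = g by apply/ffunP => p; apply: agree.
elim: t => [_|t IHt tn]; first by exists f; split=> //; exact: rt_refl.
have [g [stepg lehg agree]] := IHt (ltnW tn).
have [g' [stepg' lehg' agree']] := @fix_next_letter h (Ordinal tn) g lehg agree.
by exists g'; split=> //; apply: rt_trans stepg'.
Qed.

(** * Translation between words and matrices *)

Lemma sum_word_mx f (i : 'I_m) (q : 'I_n) :
  sum_mx (word_mx f) i q = prefix_count f i.+1 q.
Proof.
rewrite mxE exchange_big big_mkcond /=; apply: eq_bigr => p _.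
case: (p <= q) => //=; under eq_bigr => r _ do rewrite mxE.
rewrite ltnS; case: (leqP (f p) i) => [le_fi|lt_if].
  have fm : f p < m := leq_ltn_trans le_fi (ltn_ord i).
  rewrite (bigD1 (Ordinal fm)) //= eqxx big1 // => r /andP[_].
  by rewrite -val_eqE /= eq_sym => /negPf->.
by rewrite big1 // => r ri; case: eqP => // fr; lia.
Qed.

Lemma bruhat_le_word_mx h f : bruhat_le (word_mx h) (word_mx f) <-> word_le h f.
Proof.
split=> [le i q im|le i q]; last by rewrite !sum_word_mx le.
case: i im => [|i] im.
  by rewrite /prefix_count big1 // => p _; rewrite ltn0 andbF.
by have := le (Ordinal im) q; rewrite !sum_word_mx.
Qed.

Lemma Splus_word_mx (A : 'M[nat]_(m, n)) : Splus A -> exists f, A = word_mx f.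
Proof.
case=> A01 A1.
pose letter j : 'I_m.+1 :=
  if [pick i | A i j == 1] is Some i then widen_ord (leqnSn m) i else ord_max.
exists [ffun j => letter j]; apply/matrixP => i j; rewrite mxE ffunE /letter.
case: pickP => [r /eqP rj|none] /=; last first.
  have [->|Aij] := A01 i j; first by case: eqP => // mi; have := ltn_ord i; lia.
  by have := none i; rewrite Aij.
have [/val_inj<-//|ri] := altP eqP.
have [->//|Aij] := A01 i j.
(* Distinct rows [r] and [i] would both carry a 1 in column [j]. *)
have := A1 j; rewrite (cardsD1 r) (cardsD1 i) !inE rj Aij eqxx -val_eqE /=.
by rewrite eq_sym ri.
Qed.

Lemma col_word_mx_eq0 f j : (col j (word_mx f) = 0 <-> f j = ord_max)%R.
Proof.
split=> [/colP col0|fj]; last first.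
  apply/colP => i; rewrite !mxE fj /=; case: eqP => // mi.
  by have := ltn_ord i; lia.
apply/val_inj => /=; apply/eqP; rewrite eqn_leq -ltnS ltn_ord /= leqNgt.
apply/negP => fm; have := col0 (Ordinal fm).
by rewrite !mxE /= eqxx.
Qed.

Lemma col_word_mx_unit f j (k : 'I_m) :
  col j (word_mx f) = unit_vec k <-> f j = k :> nat.
Proof.
split=> [/colP /(_ k)|fj]; first by rewrite !mxE !eqxx /=; case: eqP.
by apply/colP => i; rewrite !mxE fj eqxx andbT eq_sym -val_eqE; case: eqP.
Qed.

Lemma set_col_word_mx f g j (i : 'I_m) :
    g j = i :> nat -> (forall p, p != j -> g p = f p) ->
  word_mx g = set_col j (unit_vec i) (word_mx f).
Proof.
move=> gj eqp; apply/matrixP => p q; rewrite !mxE.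
have [->|/eqp->//] := eqVneq q j.
by rewrite gj eqxx andbT eq_sym -val_eqE; case: eqP.
Qed.

Lemma xcol_word_mx f g j k :
    g j = f k -> g k = f j -> (forall p, p != j -> p != k -> g p = f p) ->
  word_mx g = xcol j k (word_mx f).
Proof.
move=> gj gk eqp; apply/matrixP => p q; rewrite !mxE.
case: perm.tpermP => [->|->|/eqP qj /eqP qk].
- by rewrite gj.
- by rewrite gk.
- by rewrite eqp.
Qed.

(** The case depends on whether [f j] is [m], that is, whether column [j] is zero. If so, a lowering
    fills it and a swap is a zero column interchange; otherwise they are a raise and a Bruhat
    interchange. *)
Lemma word_step_operation f g :
  word_step f g -> operation (word_mx f) (word_mx g).
Proof.
case=> [[j [ltj eqp]]|[j [k [jk ltf gj gk eqp]]]].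
  have gm : g j < m by have := ltn_ord (f j); lia.
  have eqg := @set_col_word_mx f g j (Ordinal gm) erefl eqp.
  have [fm|fm] := ltnP (f j) m.
    apply: Or43; exists j, (Ordinal gm), (Ordinal fm); split=> //.
    exact/col_word_mx_unit.
  apply: Or42; exists j, (Ordinal gm); split=> //.
  by apply/col_word_mx_eq0/val_inj => /=; have := ltn_ord (f j); lia.
have km : f k < m by have := ltn_ord (f j); lia.
have [fm|fm] := ltnP (f j) m.
  apply: Or41; exists (Ordinal km), (Ordinal fm), j, k; split=> //.
  - by rewrite !mxE /= !eqxx; split=> //; case: eqP => //; lia.
  - by rewrite !mxE /= gj gk !eqxx; split=> //; case: eqP => //; lia.
  - move=> p q; rewrite !inE -!val_eqE /= !mxE => npq.
    have [qj|qj] := eqVneq q j.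
      by move: npq; rewrite qj gj eqxx andbT; case: eqP; case: eqP; lia.
    have [qk|qk] := eqVneq q k; last by rewrite eqp.
    by move: npq; rewrite qk gk eqxx orbT andbT; case: eqP; case: eqP; lia.
have fj : f j = ord_max by apply/val_inj => /=; have := ltn_ord (f j); lia.
apply: Or44; exists k, j; split=> //.
- by move/col_word_mx_eq0 => fk; rewrite fk fj ltnn in ltf.
- exact/col_word_mx_eq0.
- by apply: xcol_word_mx => // p pk pj; apply: eqp.
Qed.

(** That [A] again comes from a word is part of the conclusion, so the lemma can be iterated along a
    sequence of operations. *)
Lemma operation_word_step f (A : 'M[nat]_(m, n)) :
  operation (word_mx f) A -> exists2 g, word_step f g & A = word_mx g.
Proof.
pose lower (i : 'I_m) j : {ffun 'I_n -> 'I_m.+1} :=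
  [ffun p => if p == j then widen_ord (leqnSn m) i else f p].
have lowerj i j : lower i j j = i :> nat by rewrite ffunE eqxx.
have lowerN i j p : p != j -> lower i j p = f p by rewrite ffunE => /negPf->.
pose swap j k : {ffun 'I_n -> 'I_m.+1} :=
  [ffun p => if p == j then f k else if p == k then f j else f p].
have swapl j k : swap j k j = f k by rewrite ffunE eqxx.
have swapr j k : swap j k k = f j by rewrite ffunE eqxx; case: eqP => // ->.
have swapN j k p : p != j -> p != k -> swap j k p = f p.
  by rewrite ffunE => /negPf-> /negPf->.
case=> [[i [i' [j [j' [ii jj [_ fj' fj _] [Aij Aij' Ai'j Ai'j'] eqA]]]]]
  |[j [i [fj ->]]]|[j [i [k [ik fj ->]]]]|[j [k [kj fj fk ->]]]].
- move: fj fj'; rewrite !mxE; case: eqP => // fj _; case: eqP => // fj' _.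
  exists (swap j j').
    by right; exists j, j'; split=> //; [rewrite fj fj'|exact: swapN].
  apply/matrixP => p q; rewrite mxE.
  (* Rows other than [i] and [i'] are unchanged, and there columns [j] and [j'] are zero, since each
     has its only 1 in row [i'] or [i]. *)
  have [->|qj] := eqVneq q j.
    rewrite swapl fj'; have [->|pi] := eqVneq p i; first by rewrite Aij eqxx.
    have [->|pi'] := eqVneq p i'; first by rewrite Ai'j; case: eqP => //; lia.
    rewrite eqA ?inE ?(negPf pi) ?(negPf pi') // mxE fj ![_ == val p]eq_sym.
    by rewrite !val_eqE (negPf pi) (negPf pi').
  have [->|qj'] := eqVneq q j'.
    rewrite swapr fj; have [->|pi'] := eqVneq p i'; first by rewrite Ai'j' eqxx.
    have [->|pi] := eqVneq p i; first by rewrite Aij'; case: eqP => //; lia.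
    rewrite eqA ?inE ?(negPf pi) ?(negPf pi') // mxE fj' ![_ == val p]eq_sym.
    by rewrite !val_eqE (negPf pi) (negPf pi').
  by rewrite swapN // eqA ?mxE // !inE (negPf qj) (negPf qj') andbF.
- exists (lower i j); last by apply/esym/set_col_word_mx => // p; apply: lowerN.
  left; exists j; split; last exact: lowerN.
  by move/col_word_mx_eq0: fj => ->; rewrite lowerj.
- exists (lower i j); last by apply/esym/set_col_word_mx => // p; apply: lowerN.
  left; exists j; split; last exact: lowerN.
  by move/col_word_mx_unit: fj => ->; rewrite lowerj.
- exists (swap k j); last by apply/esym/xcol_word_mx => // p pj pk; apply: swapN.
  right; exists k, j; split=> //; last exact: swapN.
  move/col_word_mx_eq0: fk => fk; rewrite fk ltn_neqAle -ltnS ltn_ord andbT.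
  by apply/eqP => fjm; apply/fj/col_word_mx_eq0/val_inj.
Qed.

End Words.

Theorem theorem4p7 (m n : nat) (A C : 'M[nat]_(m, n)) (hA : Splus A)
    (hC : Splus C) :
  bruhat_le A C <-> obtainable_from A C.
Proof.
have [h ->] := Splus_word_mx hA; have [f ->] := Splus_word_mx hC.
split=> [/bruhat_le_word_mx /word_le_steps|].
  elim=> [g g' /word_step_operation|g|g1 g2 g3 _ IH12 _ IH23].
  - exact: rt_step.
  - exact: rt_refl.
  - exact: rt_trans IH12 IH23.
(* Operations are peeled off from the starting matrix, the end known to come from a word; each one
   can only increase the partial sums. *)
move=> /clos_rt_rt1n_iff; move Ef: (word_mx f) => M; move: (word_mx h) => N steps.
elim: steps f Ef => [M' f _ i j //|M1 M2 M3 op12 _ IH f Ef].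
move: op12; rewrite -Ef => /operation_word_step[g stepg Eg] i j.
apply: leq_trans (IH g (esym Eg) i j).
rewrite Eg; exact: (iffRL (bruhat_le_word_mx g f) (word_step_le stepg)).
Qed.
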